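(* Let $k_1$ and $k_2$ be kernel functions on nonempty sets $X_1$ and $X_2$, respectively, and let $\varphi:X_2\to X_1$ be a function such that $k_1(\varphi(x),\varphi(y))\neq 0$ for all $x,y\in X_2$. Define $k:X_2\times X_2\to\mathbb{C}$ by $$k(x,y)=\frac{k_2(x,y)}{k_1(\varphi(x),\varphi(y))}.$$ Assume that $k$ is a kernel function on $X_2$. Suppose further that for some fixed $\alpha\in X_2$, the function $k(\cdot,\alpha)$ has no zeros on $X_2$ and $$\frac{1}{k(\cdot,\alpha)}\in\mathcal{M}(\mathcal{H}(k_2),\mathcal{H}(k_2)).$$ Then $C_\varphi$, $C_\varphi f=f\circ\varphi$, is a bounded linear operator from $\mathcal{H}(k_1)$ to $\mathcal{H}(k_2)$. Moreover, $$\|C_\varphi\|\leq\sqrt{k(\alpha,\alpha)}\,\left\|M_{\frac{1}{k(\cdot,\alpha)}}\right\|.$$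
   Context: A function $k:X\times X\to\mathbb{C}$ on a nonempty set $X$ is a kernel function on $X$ if $\sum_{i,j=1}^m\overline{c_i}c_jk(x_i,x_j)\ge 0$ for all $m\in\mathbb{N}$, $c_1,\dots,c_m\in\mathbb{C}$ and $x_1,\dots,x_m\in X$. $\mathcal{H}(k)$ denotes the associated reproducing kernel Hilbert space of complex-valued functions on $X$, so that $k(\cdot,y)\in\mathcal{H}(k)$ and $f(y)=\langle f,k(\cdot,y)\rangle$ for all $f\in\mathcal{H}(k)$, $y\in X$, where $k(\cdot,y)$ is the function $x\mapsto k(x,y)$. For kernel functions $k,\tilde k$ on the same set $X$, $\mathcal{M}(\mathcal{H}(k),\mathcal{H}(\tilde k))$ is the set of multipliers, i.e. functions $\psi:X\to\mathbb{C}$ with $\psi f\in\mathcal{H}(\tilde k)$ for all $f\in\mathcal{H}(k)$; for such $\psi$, $M_\psi:\mathcal{H}(k)\to\mathcal{H}(\tilde k)$, $M_\psi f=\psi f$, is the (bounded) multiplication operator and $\|M_\psi\|$ its operator norm. $\|C_\varphi\|$ is the operator norm of $C_\varphi:\mathcal{H}(k_1)\to\mathcal{H}(k_2)$. *)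

(* Defs.v *)
From HB Require Import structures.
From mathcomp Require Import all_boot all_order all_algebra.
From mathcomp Require Import sesquilinear complex.
From mathcomp Require Import all_classical all_reals all_analysis.

Set Implicit Arguments.
Unset Strict Implicit.
Unset Printing Implicit Defensive.

Import Order.TTheory GRing.Theory Num.Theory.
Import numFieldNormedType.Exports.

Local Open Scope classical_set_scope.
Local Open Scope ring_scope.

(* The order on R[i] is the partial one: 0 <= z means that z is a nonnegative
   real number. *)
Definition kernel_function (R : realType) (X : Type) (k : X -> X -> R[i]) :=
  forall (m : nat) (c : 'I_m -> R[i]) (x : 'I_m -> X),
    0 <= \sum_(i < m) \sum_(j < m) (c i)^* * c j * k (x i) (x j).

(* H(k), determined by k up to the identification of a vector f with the
   function rkhs_fun f: a Hilbert space of functions on X, i.e. a complete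
   normed space over R[i] whose norm comes from an inner product (linear in its
   first argument), embedded linearly and injectively in X -> R[i], which
   contains the functions k(., y) and has the reproducing property. *)
Record rkhs (R : realType) (X : Type) (k : X -> X -> R[i]) := Rkhs {
  rkhs_space :> completeNormedModType R[i];
  rkhs_dot : {dot rkhs_space for Num.conj};
  rkhs_normE : forall f : rkhs_space, `|f| ^+ 2 = rkhs_dot f f;
  rkhs_fun : {linear rkhs_space -> (X -> R[i])};
  rkhs_fun_inj : injective rkhs_fun;
  rkhs_ker : X -> rkhs_space;
  rkhs_kerE : forall x y : X, rkhs_fun (rkhs_ker y) x = k x y;
  rkhs_reproducing : forall (f : rkhs_space) (y : X),
    rkhs_fun f y = rkhs_dot f (rkhs_ker y)
}.

(* Norms of vectors are elements of R[i], hence the real part. The supremum is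
   taken in \bar R, so that unbounded maps have norm +oo. *)
Definition opnorm (R : realType) (V W : normedModType R[i]) (T : V -> W) :
    \bar R :=
  ereal_sup [set (complex.Re `|T f|)%:E | f in [set f : V | `|f| <= 1]].

Definition bounded_operator (R : realType) (V W : normedModType R[i])
    (T : V -> W) :=
  exists M : R, forall f : V, `|T f| <= (M%:C)%C * `|f|.

Definition multiplier (R : realType) (X : Type) (k k' : X -> X -> R[i])
    (H : rkhs k) (H' : rkhs k') : set (X -> R[i]) :=
  [set psi | forall f : H, exists g : H',
    forall x, rkhs_fun H' g x = psi x * rkhs_fun H f x].

(* M_psi f is the vector representing the function psi f; it is unique by
   rkhs_fun_inj. *)
Definition mult_op (R : realType) (X : Type) (k k' : X -> X -> R[i])
    (H : rkhs k) (H' : rkhs k') (psi : X -> R[i])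
    (psiM : multiplier H H' psi) : H -> H' :=
  fun f => projT1 (cid (psiM f)).

(* Main.v *)
Require Import Defs.
From HB Require Import structures.
From mathcomp Require Import all_boot all_order all_algebra.
From mathcomp Require Import sesquilinear complex.
From mathcomp Require Import all_classical all_reals all_analysis.
From mathcomp Require Import ring lra.

Set Implicit Arguments.
Unset Strict Implicit.
Unset Printing Implicit Defensive.

Import Order.TTheory GRing.Theory Num.Theory.
Import numFieldNormedType.Exports.

Local Open Scope classical_set_scope.
Local Open Scope ring_scope.

(** Put T f = k(., alpha) (f o phi), so that C_phi = M T for M the operator of
multiplication by 1 / k(., alpha). It is enough to see that T maps H(k1) into
H(k2) with norm at most sqrt (k(alpha, alpha)); the estimate of the norm of
C_phi follows at once, k(alpha, alpha) being positive.

A function F belongs to H(k2), with norm at most M, as soon as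
|sum c_i conj(F(y_i))| <= M |sum c_i k2(., y_i)| for all finite families
([rkhs_interpolation]): the assignment of conj(F(y)) to k2(., y) is then a
bounded linear form on the span of the kernel functions, which the Riesz
representation theorem turns into a vector ([riesz_relation]). For F = T f,
the left-hand side is the modulus of <W, f>, where
W = sum c_i conj(k(y_i, alpha)) k1(., phi(y_i)), so Cauchy-Schwarz reduces the
matter to |W|^2 <= k(alpha, alpha) |sum c_i k2(., y_i)|^2. Since
k2 = k (k1 o phi), the difference of the two sides is the quadratic form of the
entrywise product of the kernel
k(alpha, alpha) k(x, y) - k(x, alpha) k(alpha, y) with a Gram matrix of H(k1).
The former is positive by a Schur complement
([psd_schur_complement]), hence so is the product ([schur_product_gram]).

The inequality of norms says nothing when M has infinite norm, so the
boundedness of C_phi needs a separate argument. Point evaluations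
of C_phi f are inner products of f with fixed vectors, and an everywhere
defined map into H(k2) with this property is bounded ([rkhs_closed_graph]), by
the principle of uniform boundedness in a Hilbert space
([uniform_boundedness]). *)

(** * Norms as real numbers *)

(** Norms of complex vectors live in the partially ordered field R[i]; their
real parts live in R, where infima and linear arithmetic make sense. *)
Definition rnorm (R : realType) (V : normedZmodType R[i]) (v : V) : R :=
  complex.Re `|v|.

Section RealNorm.
Variable R : realType.
Local Notation C := R[i].

Lemma rnormE (V : normedZmodType C) (v : V) : (rnorm v)%:C%C = `|v|.
Proof. by rewrite /rnorm RRe_real ?normr_real. Qed.

Lemma rnorm_ge0 (V : normedZmodType C) (v : V) : 0 <= rnorm v.
Proof. by rewrite -lecR rnormE normr_ge0. Qed.

Lemma ler_rnormD (V : normedZmodType C) (u v : V) :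
  rnorm (u + v) <= rnorm u + rnorm v.
Proof. by rewrite -lecR rmorphD /= !rnormE ler_normD. Qed.

Lemma rnormN (V : normedZmodType C) (v : V) : rnorm (- v) = rnorm v.
Proof. by rewrite /rnorm normrN. Qed.

Lemma rdistrC (V : normedZmodType C) (u v : V) : rnorm (u - v) = rnorm (v - u).
Proof. by rewrite -rnormN opprB. Qed.

Lemma rnorm0 (V : normedZmodType C) : rnorm (0 : V) = 0.
Proof. by rewrite /rnorm normr0. Qed.

Lemma rnorm0_eq0 (V : normedZmodType C) (v : V) : rnorm v = 0 -> v = 0.
Proof. by move=> v0; apply: normr0_eq0; rewrite -rnormE v0. Qed.

Lemma rnormZ (V : normedModType C) (a : C) (v : V) :
  rnorm (a *: v) = rnorm a * rnorm v.
Proof. by apply: complexI; rewrite rmorphM /= !rnormE normrZ. Qed.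

Lemma rnormM (a b : C) : rnorm (a * b) = rnorm a * rnorm b.
Proof. by apply: complexI; rewrite rmorphM /= !rnormE normrM. Qed.

Lemma rnorm_conj (a : C) : rnorm a^* = rnorm a.
Proof. by rewrite /rnorm norm_conjC. Qed.

Lemma rnorm_real (a : R) : rnorm (a%:C%C) = `|a|.
Proof. by rewrite /rnorm normc_def /= expr0n addr0 sqrtr_sqr. Qed.

Lemma rnorm_sqr (a : C) : ((rnorm a) ^+ 2)%:C%C = a * a^*.
Proof. by rewrite rmorphXn /= rnormE normCK. Qed.

Lemma Re_le_rnorm (a : C) : complex.Re a <= rnorm a.
Proof.
apply: le_trans (ler_norm _) _.
by rewrite -lecR rnormE normc_ge_Re.
Qed.

Lemma ReD (a b : C) : complex.Re (a + b) = complex.Re a + complex.Re b.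
Proof. by case: a b => ? ? [? ?]. Qed.

Lemma Re_conj (a : C) : complex.Re a^* = complex.Re a.
Proof. by case: a. Qed.

End RealNorm.

(** * Inner products *)

Section Dot.
Variables (R : realType) (H : lmodType R[i]) (dot : {dot H for Num.conj}).

Lemma dotDl f g h : dot (f + g) h = dot f h + dot g h.
Proof. exact: linearDl. Qed.

Lemma dotDr f g h : dot f (g + h) = dot f g + dot f h.
Proof. exact: linearDr. Qed.

Lemma dotZl a f g : dot (a *: f) g = a * dot f g.
Proof. exact: linearZl_LR. Qed.

Lemma dotZr a f g : dot f (a *: g) = a^* * dot f g.
Proof. exact: linearZr_LR. Qed.

Lemma dot_suml (I : Type) (s : seq I) (F : I -> H) g :
  dot (\sum_(i <- s) F i) g = \sum_(i <- s) dot (F i) g.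
Proof. exact: linear_sumlz. Qed.

Lemma dot_sumr (I : Type) (s : seq I) f (F : I -> H) :
  dot f (\sum_(i <- s) F i) = \sum_(i <- s) dot f (F i).
Proof. exact: linear_sumr. Qed.

Lemma dotC f g : dot f g = (dot g f)^*.
Proof. by rewrite (hermC dot) expr0 mul1r. Qed.

End Dot.

Section InnerProduct.
Variables (R : realType) (H : normedModType R[i]) (dot : {dot H for Num.conj}).
Hypothesis dot_norm : forall f : H, `|f| ^+ 2 = dot f f.

Lemma dot_rnorm f : dot f f = (rnorm f ^+ 2)%:C%C.
Proof. by rewrite rmorphXn /= rnormE dot_norm. Qed.

Lemma rnormDZ_sqr f g t :
  rnorm (f + t *: g) ^+ 2 =
  rnorm f ^+ 2 + 2 * complex.Re (t * dot g f) + rnorm t ^+ 2 * rnorm g ^+ 2.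
Proof.
have -> : rnorm (f + t *: g) ^+ 2 = complex.Re (dot (f + t *: g) (f + t *: g)).
  by rewrite dot_rnorm.
rewrite dotDl !dotDr !dotZl !dotZr (dotC dot f g) !ReD -rmorphM /= Re_conj.
rewrite mulrA -rnorm_sqr !dot_rnorm -rmorphM /=.
lra.
Qed.

(** The squared norm of the component of f orthogonal to g is nonnegative. *)
Lemma CauchySchwarz_rnorm f g : rnorm (dot f g) <= rnorm f * rnorm g.
Proof.
have [->|g0] := eqVneq g 0.
  by rewrite linear0r !rnorm0 mulr0.
have ng : 0 < rnorm g.
  rewrite lt_neqAle rnorm_ge0 andbT eq_sym; apply: contra_neq g0.
  exact: rnorm0_eq0.
rewrite -ler_sqr ?nnegrE ?mulr_ge0 ?rnorm_ge0// exprMn.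
rewrite -ler_pdivrMr ?exprn_gt0//.
(* the vector f minus its projection on the line spanned by g *)
have := sqr_ge0 (rnorm (f + (- (rnorm g ^- 2))%:C%C * dot f g *: g)).
rewrite rnormDZ_sqr (dotC dot g f) -mulrA -rnorm_sqr -rmorphM /=.
rewrite rnormM rnorm_real.
rewrite normrN ger0_norm ?invr_ge0 ?exprn_ge0 ?rnorm_ge0//.
have -> : (rnorm g ^- 2 * rnorm (dot f g)) ^+ 2 * rnorm g ^+ 2 =
   rnorm (dot f g) ^+ 2 / rnorm g ^+ 2.
  by field; rewrite gt_eqF.
rewrite -(@mulrC _ (rnorm (dot f g) ^+ 2)) mulrN; lra.
Qed.

End InnerProduct.

(** Completeness in a quantitative form: the a priori bounds r n on the tails of
a Cauchy sequence pass to the distance to the limit. *)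
Lemma cauchy_rnorm_limit (R : realType) (H : completeNormedModType R[i])
    (h : nat -> H) (r : nat -> R) :
  (forall e, 0 < e -> exists n, r n < e) ->
  (forall n m, (n <= m)%N -> rnorm (h m - h n) <= r n) ->
  exists g : H, forall n, rnorm (g - h n) <= r n.
Proof.
move=> r0 hr.
have : cvg (h @ \oo).
  apply: cauchy_cvg; apply: cauchy_exP => e e0.
  have eE : e = (complex.Re e)%:C%C by rewrite RRe_real ?gtr0_real.
  have [n rn] := r0 (complex.Re e) ltac:(by rewrite -ltcR -eE).
  exists (h n), n => // m /= nm.
  rewrite -ball_normE /= -rnormE eE ltcR rdistrC.
  exact: le_lt_trans (hr _ _ nm) rn.
move=> /cvg_ex[g hg]; exists g => n.
apply/ler_addgt0Pr => e e0.
have /fcvgrPdist_lt/(_ e%:C%C) := hg.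
rewrite ltcR => /(_ e0) [N _ hN].
have := hN (maxn N n) (leq_maxl _ _); rewrite /= -rnormE ltcR => /ltW ge.
have -> : g - h n = (h (maxn N n) - h n) + (g - h (maxn N n)).
  by rewrite [RHS]addrC subrKA.
apply: le_trans (ler_rnormD _ _) _; apply: lerD => //.
exact: hr (leq_maxr _ _).
Qed.

(** * Riesz representation and uniform boundedness in a Hilbert space *)

Section Hilbert.
Variables (R : realType) (H : completeNormedModType R[i]).
Variable dot : {dot H for Num.conj}.
Hypothesis dot_norm : forall f : H, `|f| ^+ 2 = dot f f.
Local Notation C := R[i].

(** The Riesz representation theorem for a bounded linear form on a subspace.
The form is given by its graph G, a linear relation, because a form on a span
is most easily described by the pairs (sum c_i e_i, sum c_i l_i); the bound
makes it single-valued. The vector g is the limit of a sequence that minimizes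
J(h, l) = |h|^2 - 2 Re l over G. Everything comes from one estimate, the
first variation of J: at a point where J is close to its infimum, <., h>
nearly agrees with the form on the whole domain. This gives the Cauchy property
(compare two such points on their difference), the value of <., g> and
the bound on |g| (evaluate at the point itself). *)
Lemma riesz_relation (G : H -> C -> Prop) (M : R) :
  0 <= M -> G 0 0 ->
  (forall a h l h' l', G h l -> G h' l' -> G (h + a *: h') (l + a * l')) ->
  (forall h l, G h l -> rnorm l <= M * rnorm h) ->
  exists g : H, (forall h l, G h l -> dot h g = l) /\ rnorm g <= M.
Proof.
move=> M0 G0 GD GM.
pose J (p : H * C) := rnorm p.1 ^+ 2 - 2 * complex.Re p.2.
pose S := [set J p | p in [set p | G p.1 p.2]].
have S_inf : has_inf S.
  split; first by exists (J (0, 0)), (0, 0).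
  exists (- M ^+ 2) => _ [[h l] /= Ghl <-]; rewrite /J /=.
  have := GM _ _ Ghl; have := Re_le_rnorm l; have := sqr_ge0 (rnorm h - M).
  rewrite sqrrB -mulr_natl; lra.
have JS p : G p.1 p.2 -> inf S <= J p.
  by move=> Gp; apply: ge_inf; [exact: S_inf.2|exists p].
have variation p q : G p.1 p.2 -> G q.1 q.2 ->
    rnorm (dot q.1 p.1 - q.2) <= Num.sqrt (J p - inf S) * rnorm q.1.
  move: p q => [h l] [h' l'] /= Gp Gq.
  set b := dot h' h - l'.
  have [n0|n0] := eqVneq (rnorm h') 0.
    suff -> : b = 0 by rewrite rnorm0 n0 mulr0.
    rewrite /b (rnorm0_eq0 n0) linear0l; apply/eqP; rewrite sub0r oppr_eq0.
    apply/eqP/rnorm0_eq0/le_anti; rewrite rnorm_ge0 andbT.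
    by have := GM _ _ Gq; rewrite n0 mulr0.
  have n_gt0 : 0 < rnorm h' by rewrite lt_neqAle eq_sym n0 rnorm_ge0.
  have Jge := JS (h, l) Gp.
  rewrite -ler_sqr ?nnegrE ?mulr_ge0 ?rnorm_ge0 ?sqrtr_ge0//.
  rewrite exprMn sqr_sqrtr ?subr_ge0// -ler_pdivrMr ?exprn_gt0//.
  (* the step along q that minimizes J *)
  pose t : C := (- (rnorm h') ^- 2)%:C%C * b^*.
  have := JS (h + t *: h', l + t * l') (GD t _ _ _ _ Gp Gq).
  rewrite /J /= (rnormDZ_sqr dot_norm) ReD.
  have -> : dot h' h = b + l' by rewrite /b subrK.
  have tb : t * b = (- rnorm h' ^- 2 * rnorm b ^+ 2)%:C%C.
    by rewrite /t -mulrA [b^* * b]mulrC -rnorm_sqr -rmorphM.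
  have nt : rnorm t = rnorm h' ^- 2 * rnorm b.
    rewrite rnormM rnorm_real rnorm_conj normrN.
    by rewrite ger0_norm ?invr_ge0 ?exprn_ge0 ?rnorm_ge0.
  rewrite mulrDr ReD tb nt /=.
  have -> : (rnorm h' ^- 2 * rnorm b) ^+ 2 * rnorm h' ^+ 2 =
    rnorm b ^+ 2 / rnorm h' ^+ 2 by field.
  rewrite mulNr -(@mulrC _ (rnorm b ^+ 2)); lra.
have eps_gt0 n : 0 < n.+1%:R^-1 ^+ 2 :> R by rewrite exprn_gt0 ?invr_gt0.
have minP n : {p : H * C | G p.1 p.2 /\ Num.sqrt (J p - inf S) <= n.+1%:R^-1}.
  apply: cid.
  have [_ [p Gp <-] Jp] := inf_adherent (eps_gt0 n) S_inf.
  exists p; split => //.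
  rewrite -[leRHS]ger0_norm ?invr_ge0// -sqrtr_sqr ler_wsqrtr//.
  by rewrite lerBlDl ltW.
pose p n := sval (minP n).
have Gp n : G (p n).1 (p n).2 by rewrite /p; case: (minP n) => ? [].
have pJ n : Num.sqrt (J (p n) - inf S) <= n.+1%:R^-1.
  by rewrite /p; case: (minP n) => ? [].
have pvar n q : G q.1 q.2 ->
    rnorm (dot q.1 (p n).1 - q.2) <= n.+1%:R^-1 * rnorm q.1.
  move=> Gq; apply: le_trans (variation _ _ (Gp n) Gq) _.
  by rewrite ler_wpM2r ?rnorm_ge0.
have inv_lt e : 0 < e -> exists n, 2 * n.+1%:R^-1 < e :> R.
  move=> e0; exists (Num.truncn (2 / e)).
  rewrite -ltr_pdivlMl// [ltRHS]mulrC.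
  by rewrite invf_plt ?posrE ?divr_gt0// invf_div truncnS_gt.
have [g gp] : exists g : H, forall n, rnorm (g - (p n).1) <= 2 * n.+1%:R^-1.
  apply: cauchy_rnorm_limit => // n m nm.
  have Gq : G ((p m).1 - (p n).1) ((p m).2 - (p n).2).
    by have := GD (-1) _ _ _ _ (Gp m) (Gp n); rewrite scaleN1r mulN1r.
  set d := (p m).1 - (p n).1.
  have : rnorm (dot d d) <= 2 * n.+1%:R^-1 * rnorm d.
    have -> : dot d d = (dot d (p m).1 - ((p m).2 - (p n).2)) -
                       (dot d (p n).1 - ((p m).2 - (p n).2)).
      by rewrite {2}/d linearBr; ring.
    apply: le_trans (ler_rnormD _ _) _; rewrite rnormN.
    apply: le_trans (lerD (pvar m (_, _) Gq) (pvar n (_, _) Gq)) _ => /=.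
    rewrite -mulrDl ler_wpM2r ?rnorm_ge0// mulrDl mul1r lerD2r.
    by rewrite lef_pV2 ?posrE// ler_nat.
  rewrite (dot_rnorm dot_norm) rnorm_real ger0_norm ?sqr_ge0//.
  have [->|d0] := eqVneq (rnorm d) 0; first by rewrite mulr_ge0 ?invr_ge0.
  by rewrite expr2 ler_pM2r// lt_neqAle eq_sym d0 rnorm_ge0.
(* inequalities valid up to a multiple of 2 / (n + 1) hold in the limit *)
have small (x c : R) : 0 <= c ->
    (forall n, x <= c * (2 * n.+1%:R^-1)) -> x <= 0.
  move=> c0 xc; apply/ler_addgt0Pr => e e0; rewrite add0r.
  have [n /ltW ne] := inv_lt (e / (c + 1)) ltac:(by rewrite divr_gt0 ?ltr_wpDl).
  apply: le_trans (xc n) _.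
  have : (c + 1) * (2 * n.+1%:R^-1) <= e by rewrite mulrC -ler_pdivlMr ?ltr_wpDl.
  by apply: le_trans; rewrite ler_wpM2r ?mulr_ge0 ?invr_ge0// lerDl.
exists g; split => [h l Ghl|].
  apply/eqP; rewrite -subr_eq0; apply/eqP/rnorm0_eq0/le_anti.
  rewrite rnorm_ge0 andbT.
  apply: (small _ (2 * rnorm h)); first by rewrite mulr_ge0 ?rnorm_ge0.
  move=> n.
  have -> : dot h g - l = dot h (g - (p n).1) + (dot h (p n).1 - l).
    by rewrite linearBr; ring.
  apply: le_trans (ler_rnormD _ _) _.
  have := CauchySchwarz_rnorm dot_norm h (g - (p n).1).
  have := pvar n (h, l) Ghl; have := ler_wpM2l (rnorm_ge0 h) (gp n) => /=.
  have : 0 <= n.+1%:R^-1 * rnorm h by rewrite mulr_ge0 ?invr_ge0 ?rnorm_ge0.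
  set i := n.+1%:R^-1; nra.
rewrite -subr_le0; apply: (small _ 2) => // n.
have pM : rnorm (p n).1 <= M + n.+1%:R^-1.
  have [->|n0] := eqVneq (rnorm (p n).1) 0.
    by rewrite addr_ge0 ?invr_ge0.
  have n_gt0 : 0 < rnorm (p n).1 by rewrite lt_neqAle eq_sym n0 rnorm_ge0.
  rewrite -(ler_pM2r n_gt0) -expr2 mulrDl.
  have -> : rnorm (p n).1 ^+ 2 =
      rnorm ((p n).2 + (dot (p n).1 (p n).1 - (p n).2)).
    by rewrite addrC subrK (dot_rnorm dot_norm) rnorm_real ger0_norm ?sqr_ge0.
  apply: le_trans (ler_rnormD _ _) _; apply: lerD; first exact: GM.
  exact: pvar.
have := ler_rnormD (g - (p n).1) (p n).1; rewrite subrK.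
have := gp n; have : 0 <= n.+1%:R^-1 :> R by rewrite invr_ge0.
by move: pM; set i := n.+1%:R^-1; lra.
Qed.
(** The gliding hump, without Baire's theorem. If no K works, choose vectors v_n
whose norms exceed n (2 3^n) times their weights, and add to x_n a multiple of
v_n of norm 3^-n, with the sign that makes <x_(n+1), v_n> at least 3^-n |v_n|:
one of <x + u, v> and <x - u, v> is at least <u, v> in modulus. The later steps
add up to 3^-n / 2, so the limit y has |<y, v_n>| >= 3^-n |v_n| / 2, which is
more than n times the weight of v_n. With the weights b, bounds on a unit ball
need no normalization, even where b vanishes. *)
Lemma uniform_boundedness (I : Type) (w : I -> H) (b : I -> R) :
  (forall i, 0 <= b i) ->
  (forall f, exists A, forall i, rnorm (dot f (w i)) <= A * b i) ->
  exists K, 0 <= K /\ forall i, rnorm (w i) <= K * b i.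
Proof.
move=> b0 wb; apply: contrapT => noK.
pose q n : R := (3 ^+ n)^-1.
have q0 n : 0 < q n by rewrite invr_gt0 exprn_gt0.
have /choice[idx idxP] :
    forall n, exists i, n%:R * (2 * 3 ^+ n) * b i < rnorm (w i).
  move=> n; apply: contrapT => small; apply: noK.
  exists (n%:R * (2 * 3 ^+ n)); split=> [|i].
    by rewrite !mulr_ge0 ?exprn_ge0.
  by rewrite leNgt; apply/negP => ?; apply: small; exists i.
pose v n := w (idx n).
have v_big n : n%:R * b (idx n) < q n / 2 * rnorm (v n).
  rewrite -(ltr_pM2l (_ : 0 < 2 * 3 ^+ n)) ?mulr_gt0 ?exprn_gt0//.
  rewrite mulrA [_ * n%:R]mulrC; apply: lt_le_trans (idxP n) _.
  rewrite /q le_eqVlt; apply/orP; left; apply/eqP; field.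
  by rewrite expf_neq0.
have step n (x : H) : {y | rnorm (y - x) <= q n /\
    q n * rnorm (v n) <= rnorm (dot y (v n))}.
  apply: cid.
  have v0 : 0 < rnorm (v n).
    rewrite -(pmulr_rgt0 _ (_ : 0 < q n / 2)) ?divr_gt0//.
    by apply: le_lt_trans (v_big n); rewrite mulr_ge0.
  pose u := (q n / rnorm (v n))%:C%C *: v n.
  have nu : rnorm u = q n.
    rewrite rnormZ rnorm_real ger0_norm ?divr_ge0 ?rnorm_ge0 ?(ltW (q0 n))//.
    by rewrite divfK ?gt_eqF.
  have duv : rnorm (dot u (v n)) = q n * rnorm (v n).
    rewrite (dotZl dot) (dot_rnorm dot_norm) -rmorphM rnorm_real ger0_norm.
      by rewrite expr2 mulrA divfK ?gt_eqF.
    by rewrite !mulr_ge0 ?invr_ge0 ?exprn_ge0 ?rnorm_ge0 ?(ltW (q0 n)).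
  rewrite -duv.
  have : 2 * rnorm (dot u (v n)) <=
      rnorm (dot (x + u) (v n)) + rnorm (dot (x - u) (v n)).
    rewrite -[in leRHS](rnormN (dot (x - u) _)).
    apply: le_trans (ler_rnormD _ _).
    have -> : dot (x + u) (v n) + - dot (x - u) (v n) =
      2%:R%:C%C * dot u (v n).
      by rewrite (linearDl dot) (linearBl dot) rmorph_nat; ring.
    by rewrite rnormM rnorm_real normr_nat.
  have [xu|xu] := leP (rnorm (dot u (v n))) (rnorm (dot (x + u) (v n))) => h.
    by exists (x + u); rewrite addrAC subrr add0r nu.
  exists (x - u); rewrite addrAC subrr add0r rnormN nu; split => //; lra.
pose fix x n := if n is m.+1 then sval (step m (x m)) else 0.
have xS n : rnorm (x n.+1 - x n) <= q n by have [] := svalP (step n (x n)).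
have xv n : q n * rnorm (v n) <= rnorm (dot (x n.+1) (v n)).
  by have [] := svalP (step n (x n)).
have qS n : q n.+1 = q n / 3 by rewrite /q exprS invfM mulrC.
have geom n d : rnorm (x (d + n)%N - x n) <= 3 / 2 * (q n - q (d + n)%N).
  elim: d => [|d IH]; first by rewrite add0n !subrr rnorm0 mulr0.
  rewrite addSn -(subrKA (x (d + n)%N)).
  apply: le_trans (ler_rnormD _ _) _.
  have := xS (d + n)%N; rewrite qS; lra.
have [y yx] : exists y : H, forall n, rnorm (y - x n) <= 3 / 2 * q n.
  apply: cauchy_rnorm_limit => [e e0|n m nm].
    exists (Num.truncn (3 / 2 / e)); set n := Num.truncn _.
    have n3 : n.+1%:R <= 3 ^+ n :> R by rewrite -natrX ler_nat ltn_expl.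
    rewrite /q -ltr_pdivlMl ?divr_gt0// [ltRHS]mulrC.
    rewrite invf_plt ?posrE ?mulr_gt0 ?exprn_gt0 ?invr_gt0 ?divr_gt0//.
    apply: lt_le_trans n3; rewrite invfM invrK mulrC; exact: truncnS_gt.
  have := geom n (m - n)%N; rewrite subnK// => /le_trans; apply.
  by have := q0 m; lra.
have [A yA] := wb y.
have := v_big (Num.truncn A).+1; set n := (Num.truncn A).+1.
apply/negP; rewrite -leNgt.
have : q n * rnorm (v n) <= rnorm (dot y (v n)) + q n / 2 * rnorm (v n).
  apply: le_trans (xv n) _.
  have -> : dot (x n.+1) (v n) = dot y (v n) + - dot (y - x n.+1) (v n).
    by rewrite (linearBl dot) opprB addrC subrK.
  apply: le_trans (ler_rnormD _ _) _; rewrite rnormN lerD2l.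
  apply: le_trans (CauchySchwarz_rnorm dot_norm _ _) _.
  rewrite ler_wpM2r ?rnorm_ge0//; have := yx n.+1; rewrite qS; lra.
have An : A * b (idx n) <= n%:R * b (idx n).
  by rewrite ler_wpM2r// ltW// truncnS_gt.
have := yA (idx n); rewrite -/(v n); lra.
Qed.

End Hilbert.

(** * Membership and boundedness in a reproducing kernel Hilbert space *)

Section Rkhs.
Variables (R : realType) (X : Type) (k : X -> X -> R[i]) (H : rkhs k).
Local Notation C := R[i].
Local Notation dot := (rkhs_dot H).
Local Notation ker := (rkhs_ker H).

Definition kernel_comb (s : seq (C * X)) : H := \sum_(p <- s) p.1 *: ker p.2.

Lemma rkhs_funZ a (f : H) x : rkhs_fun H (a *: f) x = a * rkhs_fun H f x.
Proof. by rewrite linearZ. Qed.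

Lemma dot_kernel_comb f s :
  dot f (kernel_comb s) = \sum_(p <- s) p.1^* * rkhs_fun H f p.2.
Proof.
rewrite /kernel_comb dot_sumr; apply: eq_bigr => p _.
by rewrite dotZr rkhs_reproducing.
Qed.

Lemma dot_ker x y : dot (ker y) (ker x) = k x y.
Proof. by rewrite -rkhs_reproducing rkhs_kerE. Qed.

(** The Riesz theorem applied to the form that takes the value conj(F(y)) at
k(., y): the reproducing property says that the vector representing it is F. *)
Lemma rkhs_interpolation (F : X -> C) (M : R) : 0 <= M ->
  (forall s, rnorm (\sum_(p <- s) p.1 * (F p.2)^*) <=
             M * rnorm (kernel_comb s)) ->
  exists g : H, (forall x, rkhs_fun H g x = F x) /\ rnorm g <= M.
Proof.
move=> M0 FM.
pose G (h : H) (l : C) := exists2 s, h = kernel_comb s &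
  l = \sum_(p <- s) p.1 * (F p.2)^*.
have [||h l [s -> ->]|g [gG gM]] :=
  @riesz_relation _ _ _ (@rkhs_normE _ _ _ H) G M M0.
- by exists [::]; rewrite /kernel_comb !big_nil.
- move=> a h l h' l' [s -> ->] [s' -> ->].
  exists (s ++ [seq (a * p.1, p.2) | p <- s']).
    rewrite /kernel_comb big_cat big_map /= scaler_sumr.
    by congr (_ + _); apply: eq_bigr => p _; rewrite scalerA.
  rewrite big_cat big_map /= mulr_sumr.
  by congr (_ + _); apply: eq_bigr => p _; rewrite mulrA.
- exact: FM.
exists g; split => // x; rewrite rkhs_reproducing (dotC dot).
rewrite (gG _ (F x)^*) ?conjCK//; exists [:: (1, x)].
  by rewrite /kernel_comb big_seq1 scale1r.
by rewrite big_seq1 mul1r.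
Qed.

End Rkhs.

(** The closed graph theorem for maps with values in a reproducing kernel space.
The adjoint of T sends a combination of kernel functions to W s. Uniform
boundedness, applied to the functionals <., W s> = <T ., kernel_comb s>, bounds
that adjoint on the span; the interpolation lemma then reconstructs T f from
its values, with the corresponding norm. *)
Lemma rkhs_closed_graph (R : realType) (X1 X2 : Type)
    (k1 : X1 -> X1 -> R[i]) (k2 : X2 -> X2 -> R[i])
    (H1 : rkhs k1) (H2 : rkhs k2) (T : H1 -> H2) (w : X2 -> H1) :
  (forall f y, rkhs_fun H2 (T f) y = rkhs_dot H1 f (w y)) ->
  exists K, 0 <= K /\ forall f, rnorm (T f) <= K * rnorm f.
Proof.
move=> Tw.
pose W (s : seq (R[i] * X2)) := \sum_(p <- s) p.1 *: w p.2.
have dotW f s : rkhs_dot H1 f (W s) = rkhs_dot H2 (T f) (kernel_comb H2 s).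
  rewrite dot_kernel_comb dot_sumr.
  by apply: eq_bigr => p _; rewrite dotZr Tw.
have [||K [K0 WK]] := @uniform_boundedness _ _ _ (@rkhs_normE _ _ _ H1) _ W
  (fun s => rnorm (kernel_comb H2 s)).
- by move=> s; exact: rnorm_ge0.
- move=> f; exists (rnorm (T f)) => s; rewrite dotW.
  exact: (CauchySchwarz_rnorm (@rkhs_normE _ _ _ H2)).
exists K; split => // f.
have [||g [gT gK]] := @rkhs_interpolation _ _ _ H2 (rkhs_fun H2 (T f))
  (K * rnorm f).
- by rewrite mulr_ge0 ?rnorm_ge0.
- move=> s.
  have -> : \sum_(p <- s) p.1 * (rkhs_fun H2 (T f) p.2)^* =
      rkhs_dot H1 (W s) f.
    rewrite dot_suml; apply: eq_bigr => p _.
    by rewrite (dotZl (rkhs_dot H1)) (dotC (rkhs_dot H1)) Tw.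
  apply: le_trans (CauchySchwarz_rnorm (@rkhs_normE _ _ _ H1) _ _) _.
  by rewrite mulrAC ler_wpM2r ?rnorm_ge0.
suff -> : T f = g by [].
by apply: (@rkhs_fun_inj _ _ _ H2); apply/funext => y; rewrite gT.
Qed.

(** * Positive kernels: Schur complements and Schur products *)

Section Kernels.
Variables (R : realType).
Local Notation C := R[i].

(** Kernel functions tested on lists of weighted points, the form suited to
adding a point and to induction. *)
Definition psd (X : Type) (k : X -> X -> C) := forall s : seq (C * X),
  0 <= \sum_(p <- s) \sum_(q <- s) p.1^* * q.1 * k p.2 q.2.

Lemma kernel_psd (X : Type) (k : X -> X -> C) : kernel_function k -> psd k.
Proof.
move=> kk [|p0 s]; first by rewrite big_nil.
rewrite (big_nth p0) big_mkord.
under eq_bigr do rewrite (big_nth p0) big_mkord.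
exact: kk.
Qed.

Lemma psd_diag_ge0 (X : Type) (k : X -> X -> C) x : psd k -> 0 <= k x x.
Proof. by move=> /(_ [:: (1, x)]); rewrite !big_seq1 /= conjC1 !mul1r. Qed.

(** The quadratic form is real on the weights (1, 1) and (1, i), which are
enough to compare k x y with k y x. *)
Lemma psd_hermitian (X : Type) (k : X -> X -> C) x y : psd k ->
  k y x = (k x y)^*.
Proof.
move=> kk.
have /ger0_Im kxx := psd_diag_ge0 x kk.
have /ger0_Im kyy := psd_diag_ge0 y kk.
have /ger0_Im := kk [:: (1, x); (1, y)].
have /ger0_Im := kk [:: (1, x); ('i%C, y)].
rewrite !big_cons !big_nil /= conjC1 !mul1r !addr0.
case: (k x x) (k y y) (k x y) (k y x) kxx kyy => ? ? [? ?] [a b] [c d] /= -> ->.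
move=> h1 h2; apply/eqP; rewrite eq_complex /=.
by apply/andP; split; apply/eqP; move: h1 h2; lra.
Qed.

(** Adding the point a with weight t to weighted points scaled by r turns the
quadratic form of k into that of [aux]. When k a a > 0, the choice
t = - conj(b), r = k a a gives k a a times the form of the complement. When
k a a = 0, letting t be a large multiple of conj(b) shows that b = 0. *)
Lemma psd_schur_complement (X : Type) (k : X -> X -> C) a :
  psd k -> psd (fun x y => k a a * k x y - k x a * k a y).
Proof.
move=> kk s.
set S := \sum_(p <- s) \sum_(q <- s) p.1^* * q.1 * k p.2 q.2.
pose b := \sum_(p <- s) p.1^* * k p.2 a.
have bC : b^* = \sum_(q <- s) q.1 * k a q.2.
  rewrite /b rmorph_sum; apply: eq_bigr => q _ /=.
  by rewrite rmorphM /= conjCK (psd_hermitian q.2 a kk).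
have -> : \sum_(p <- s) \sum_(q <- s)
    p.1^* * q.1 * (k a a * k p.2 q.2 - k p.2 a * k a q.2) = k a a * S - b * b^*.
  rewrite bC /b /S mulr_suml mulr_sumr -sumrB; apply: eq_bigr => p _.
  rewrite !mulr_sumr -sumrB; apply: eq_bigr => q _.
  by rewrite -[X in X - _]/(k a a * _); ring.
have aux (t r : C) : r \is Num.real ->
  0 <= t^* * t * k a a + r * (t^* * b^* + t * b) + r ^+ 2 * S.
  move=> rr; have := kk ((t, a) :: [seq (r * p.1, p.2) | p <- s]).
  rewrite !big_cons !big_map /=.
  under [X in _ + X]eq_bigr do rewrite big_cons big_map /=.
  rewrite big_split /=.
  suff [-> -> ->] :
   [/\ \sum_(j <- s) t^* * (r * j.1) * k a j.2 = r * (t^* * b^*),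
     \sum_(p <- s) (r * p.1)^* * t * k p.2 a = r * (t * b)
     & \sum_(p <- s) \sum_(q <- s) (r * p.1)^* * (r * q.1) * k p.2 q.2 =
       r ^+ 2 * S].
    by rewrite mulrDr !addrA.
  rewrite bC /b /S !mulr_sumr; split; apply: eq_bigr => p _.
  - by ring.
  - by rewrite rmorphM /= (conj_Creal rr); ring.
  - rewrite mulr_sumr; apply: eq_bigr => q _.
    by rewrite rmorphM /= (conj_Creal rr); ring.
have a0 := psd_diag_ge0 a kk.
have S0 : 0 <= S := kk s.
have [ka0|ka0] := eqVneq (k a a) 0.
  suff -> : b = 0 by rewrite ka0 !mul0r subrr.
  apply/eqP; apply: contraT => b0.
  have bb : 0 < b * b^* by rewrite -normCK exprn_gt0 ?normr_gt0.
  pose r := (S + 1) / (b * b^*).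
  have rr : r \is Num.real.
    by rewrite ger0_real ?divr_ge0 ?addr_ge0 ?(ltW bb).
  (* r is chosen so that the form takes the value - (S + 2) *)
  have := aux (- r * b^*) 1 (rpred1 _).
  rewrite ka0 mulr0 add0r expr1n !mul1r rmorphM rmorphN /=.
  rewrite (conj_Creal rr) conjCK.
  have -> : - r * b * b^* + - r * b^* * b + S = - (S + 2).
    have -> : - r * b * b^* + - r * b^* * b = - (r * (b * b^*)) *+ 2 by ring.
    by rewrite /r divfK ?gt_eqF//; ring.
  by rewrite oppr_ge0 lt_geF// ltr_wpDl.
have kaa_gt0 : 0 < k a a by rewrite lt_neqAle eq_sym ka0.
have := aux (- b^*) (k a a) (ger0_real a0).
rewrite rmorphN /= conjCK => h.
rewrite -(pmulr_rge0 _ kaa_gt0); apply: le_trans h _.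
by rewrite le_eqVlt; apply/orP; left; apply/eqP; ring.
Qed.

(** The Schur product theorem when one factor is the Gram matrix of vectors,
by Gaussian elimination on the other factor. With x the first point, B x x B is
the rank-one kernel B(y, x) B(x, z), which contributes the squared norm of
w, plus the Schur complement of B at x, which vanishes on the row and column of
x, so that the induction hypothesis applies to the remaining points. *)
Lemma schur_product_gram (X : Type) (U : lmodType C)
    (dot : {dot U for Num.conj}) (s : seq (X * U)) (B : X -> X -> C) : psd B ->
  0 <= \sum_(p <- s) \sum_(q <- s) B q.1 p.1 * dot p.2 q.2.
Proof.
elim: s B => [|[x u] s IH] B BB; first by rewrite big_nil.
pose Q (B : X -> X -> C) (s : seq (X * U)) :=
  \sum_(p <- s) \sum_(q <- s) B q.1 p.1 * dot p.2 q.2.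
have Q_cons0 B' : (forall y, B' x y = 0) -> (forall y, B' y x = 0) ->
    Q B' ((x, u) :: s) = Q B' s.
  move=> B'l B'r; rewrite /Q big_cons big1 ?add0r => [|q _].
    by apply: eq_bigr => p _; rewrite big_cons /= B'l mul0r add0r.
  by rewrite /= B'r mul0r.
have BC : psd (fun y z => B x x * B y z - B y x * B x z).
  exact: psd_schur_complement.
have [B0|B0] := eqVneq (B x x) 0.
  have Bx y : B x y = 0.
    have := psd_diag_ge0 y BC; rewrite /= B0 mul0r sub0r oppr_ge0.
    rewrite (psd_hermitian x y BB) mulrC -normCK => h.
    by apply/eqP; rewrite -normr_le0 -(@ler_pXn2r _ 2) ?nnegrE// expr0n.
  rewrite -/(Q B _) Q_cons0//; first exact: IH.
  by move=> y; rewrite (psd_hermitian x y BB) Bx conjC0.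
have Bpos : 0 < B x x by rewrite lt_neqAle eq_sym B0 psd_diag_ge0.
rewrite -(pmulr_rge0 _ Bpos) -/(Q B _).
pose w := \sum_(p <- (x, u) :: s) B x p.1 *: p.2.
have -> : B x x * Q B ((x, u) :: s) =
    Q (fun y z => B x x * B y z - B y x * B x z) ((x, u) :: s) + dot w w.
  rewrite /w dot_suml /Q mulr_sumr -big_split; apply: eq_bigr => p _ /=.
  rewrite dot_sumr mulr_sumr -big_split; apply: eq_bigr => q _ /=.
  rewrite (dotZl dot) (dotZr dot) (psd_hermitian x q.1 BB); ring.
rewrite Q_cons0 => [||y]; last by rewrite mulrC subrr.
  by rewrite addr_ge0 ?dnorm_ge0//; exact: IH.
by move=> y; rewrite subrr.
Qed.

End Kernels.

Theorem theorem4p1 (R : realType) (X1 X2 : Type)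
  (X1_nonempty : inhabited X1) (X2_nonempty : inhabited X2)
  (k1 : X1 -> X1 -> R[i]) (k2 : X2 -> X2 -> R[i])
  (k1_kernel : kernel_function k1) (k2_kernel : kernel_function k2)
  (H1 : rkhs k1) (H2 : rkhs k2)
  (phi : X2 -> X1)
  (k1_phi_neq0 : forall x y : X2, k1 (phi x) (phi y) != 0)
  (k : X2 -> X2 -> R[i])
  (kE : forall x y : X2, k x y = k2 x y / k1 (phi x) (phi y))
  (k_kernel : kernel_function k)
  (alpha : X2)
  (k_alpha_neq0 : forall x : X2, k x alpha != 0)
  (inv_k_mult : multiplier H2 H2 (fun x => (k x alpha)^-1)) :
  exists C : {linear H1 -> H2},
    [/\ forall (f : H1) (x : X2), rkhs_fun H2 (C f) x = rkhs_fun H1 f (phi x),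
        bounded_operator C &
        (opnorm C <=
          (Num.sqrt (complex.Re (k alpha alpha)))%:E *
          opnorm (mult_op inv_k_mult))%E].
Proof.
have k_psd := kernel_psd k_kernel.
have k2E x y : k2 x y = k x y * k1 (phi x) (phi y) by rewrite kE divfK.
set s := Num.sqrt _.
have kaa : k alpha alpha = (complex.Re (k alpha alpha))%:C%C.
  by rewrite RRe_real// ger0_real// psd_diag_ge0.
have kaa_gt0 : 0 < complex.Re (k alpha alpha).
  by rewrite -ltcR -kaa lt_neqAle eq_sym k_alpha_neq0 psd_diag_ge0.
have s_gt0 : 0 < s by rewrite sqrtr_gt0.
pose M := mult_op inv_k_mult.
have ME h x : rkhs_fun H2 (M h) x = (k x alpha)^-1 * rkhs_fun H2 h x.
  exact: (projT2 (cid (inv_k_mult h))).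
have /choice[T TP] : forall f : H1, exists g : H2,
    (forall x, rkhs_fun H2 g x = k x alpha * rkhs_fun H1 f (phi x)) /\
    rnorm g <= s * rnorm f.
  move=> f; apply: rkhs_interpolation => [|t].
    by rewrite mulr_ge0 ?rnorm_ge0 ?(ltW s_gt0).
  pose W := kernel_comb H1 [seq (p.1 * (k p.2 alpha)^*, phi p.2) | p <- t].
  have -> : \sum_(p <- t) p.1 * (k p.2 alpha * rkhs_fun H1 f (phi p.2))^* =
      rkhs_dot H1 W f.
    rewrite (dotC (rkhs_dot H1)) dot_kernel_comb big_map rmorph_sum.
    by apply: eq_bigr => p _ /=; rewrite !rmorphM /= !conjCK; ring.
  apply: le_trans (CauchySchwarz_rnorm (@rkhs_normE _ _ _ H1) _ _) _.
  rewrite mulrAC ler_wpM2r ?rnorm_ge0//.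
  rewrite -ler_sqr ?nnegrE ?mulr_ge0 ?rnorm_ge0 ?(ltW s_gt0)//.
  rewrite exprMn sqr_sqrtr ?(ltW kaa_gt0)// -lecR.
  rewrite -(dot_rnorm (@rkhs_normE _ _ _ H1)).
  rewrite rmorphM /= -kaa -(dot_rnorm (@rkhs_normE _ _ _ H2)).
  rewrite -subr_ge0.
  (* with the coefficients put into the vectors, the Gram matrix gives both
     sides, and the factors k(., alpha) of W are the rank-one part of the
     complement *)
  have := schur_product_gram (rkhs_dot H1)
    [seq (p.2, p.1 *: rkhs_ker H1 (phi p.2)) | p <- t]
    (psd_schur_complement alpha k_psd).
  congr (0 <= _); rewrite big_map /W /kernel_comb big_map.
  rewrite !dot_suml mulr_sumr -sumrB; apply: eq_bigr => p _ /=.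
  rewrite !dot_sumr !big_map mulr_sumr -sumrB; apply: eq_bigr => q _ /=.
  rewrite !(dotZl (rkhs_dot H1)) !(dotZr (rkhs_dot H1)) !dot_ker.
  rewrite !(dotZl (rkhs_dot H2)) !(dotZr (rkhs_dot H2)) !dot_ker.
  rewrite k2E rmorphM /= conjCK (psd_hermitian p.2 alpha k_psd).
  by ring.
have funT f x : rkhs_fun H2 (T f) x = k x alpha * rkhs_fun H1 f (phi x).
  by have [-> _] := TP f.
(* the factor k(., alpha) put in by T is cancelled by M *)
pose C0 f := M (T f).
have C0E f x : rkhs_fun H2 (C0 f) x = rkhs_fun H1 f (phi x).
  by rewrite ME funT mulKf.
have C0_linear : linear C0.
  move=> a f g; apply: (@rkhs_fun_inj _ _ _ H2); apply/funext => x.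
  by rewrite C0E !linearP /= !fctE !C0E.
pose C : {linear H1 -> H2} :=
  HB.pack C0 (GRing.isLinear.Build _ _ _ _ C0 C0_linear).
exists C; split => //.
  have [|K [K0 CK]] :=
    @rkhs_closed_graph _ _ _ _ _ H1 H2 C0 (rkhs_ker H1 \o phi).
    by move=> f y; rewrite C0E rkhs_reproducing.
  by exists K => f; rewrite -!rnormE -rmorphM /= lecR CK.
apply: ge_ereal_sup => _ [f /= f1 <-].
(* T f / s lies in the unit ball, on which M is controlled by its norm *)
pose u := (s^-1)%:C%C *: T f.
have -> : C0 f = s%:C%C *: M u.
  apply: (@rkhs_fun_inj _ _ _ H2); apply/funext => x.
  rewrite C0E rkhs_funZ ME rkhs_funZ funT.
  rewrite (mulrCA _^-1) mulKf// mulrA -rmorphM /= mulfV ?gt_eqF//.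
  by rewrite mul1r.
rewrite -/(rnorm _) rnormZ rnorm_real gtr0_norm// EFinM.
rewrite lee_pmul2l ?lte_fin//.
apply: ereal_sup_ubound; exists u => //=.
rewrite -rnormE (_ : 1 = 1%:C%C)// lecR rnormZ rnorm_real.
rewrite gtr0_norm ?invr_gt0// ler_pdivrMl// mulr1.
apply: le_trans (TP f).2 _; rewrite ger_pMr//.
by rewrite -lecR rnormE.
Qed.
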